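(* Let $G$ be a non-bipartite graph. Then $I_c(G)^{(n)}\subset I(G)^{(n)}$ for all $n\geq 1$ and $\widehat{\alpha}(I(G))\leq\widehat{\alpha}(I_c(G))$.
   Context: Graphs are finite and simple; $V(G)=\{t_1,\ldots,t_s\}$ and $S=K[t_1,\ldots,t_s]$ is the polynomial ring over a field $K$. The edge ideal $I(G)$ is the ideal of $S$ generated by all $t_it_j$ with $\{t_i,t_j\}$ an edge of $G$. A vertex cover of $G$ is a set of vertices meeting every edge; it is minimal if it is minimal with respect to inclusion. The ideal of covers $I_c(G)$ is the ideal of $S$ generated by all squarefree monomials $\prod_{t_i\in D}t_i$ with $D$ a minimal vertex cover of $G$. For an ideal $I$ of $S$ with minimal primes $\mathfrak{p}_1,\ldots,\mathfrak{p}_r$ and $n\geq 1$, the $n$-th symbolic power is $I^{(n)}=\bigcap_{i=1}^r(I^nS_{\mathfrak{p}_i}\cap S)$. For a squarefree monomial ideal $I$, the Waldschmidt constant is $\widehat{\alpha}(I)=\lim_{n\to\infty}\alpha(I^{(n)})/n$, where $\alpha(L)$ is the least degree of a minimal generator of the monomial ideal $L$ (this limit exists). *)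

(* Defs.v *)
From mathcomp Require Import all_boot all_order all_algebra.
From mathcomp Require Import ring_quotient fraction.
(* mpoly has to be imported before mathcomp-analysis: in the other order their
   notations clash. *)
From mathcomp Require Import mpoly.
From mathcomp Require Import boolp classical_sets reals topology normedtype.
From mathcomp Require Import sequences.

Set Implicit Arguments.
Unset Strict Implicit.
Unset Printing Implicit Defensive.

Import GRing.Theory.
Import numFieldNormedType.Exports.

Local Open Scope classical_set_scope.
Local Open Scope ring_scope.

(* The finite sums of products b * a with b \in B and a \in A; when B is a
   subring of F this is the B-submodule of F generated by A. *)
Definition lincomb (F : comNzRingType) (B A : set F) : set F :=
  [set x | exists (k : nat) (b a : 'I_k -> F),
     [/\ forall i, B (b i), forall i, A (a i) & x = \sum_(i < k) b i * a i]].

Section Ideals.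
Variable R : comNzRingType.
Implicit Types (A I p q : set R) (n : nat).

Definition ideal_gen A : set R := lincomb setT A.

(* For n = 0 the only product is the empty one, so the power is the ring. *)
Definition ideal_pow I n : set R :=
  ideal_gen [set x | exists2 a : 'I_n -> R,
     forall i, I (a i) & x = \prod_(i < n) a i].

(* idealr_closed includes properness (1 \notin p). *)
Definition prime_ideal p : Prop :=
  idealr_closed [pred x | x \in p] /\ prime_idealr_closed [pred x | x \in p].

Definition minimal_primes I : set (set R) :=
  [set p | [/\ prime_ideal p, I `<=` p &
     forall q, prime_ideal q -> I `<=` q -> q `<=` p -> q = p]].

End Ideals.

Section SymbolicPowers.
Variable R : idomainType.
Implicit Types (I J p : set R) (n : nat).

(* The localization of the domain R at the prime p, as a subring of its field
   of fractions. *)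
Definition localization p : set {fraction R} :=
  [set x | exists a d : R, ~ p d /\ x = tofrac a / tofrac d].

(* J R_p \cap R *)
Definition loc_contraction J p : set R :=
  @tofrac R @^-1` lincomb (localization p) (@tofrac R @` J).

Definition symbolic_power I n : set R :=
  \bigcap_(p in minimal_primes I) loc_contraction (ideal_pow I n) p.

End SymbolicPowers.

Section MonomialIdeals.
Variables (s : nat) (K : fieldType).
Implicit Types (L : set {mpoly K[s]}) (A B : set 'X_{1..s}).

Definition monomials A : set {mpoly K[s]} := (fun m => 'X_[K, m]) @` A.

Definition minimal_generating_set L A : Prop :=
  ideal_gen (monomials A) = L /\
  forall B, B `<=` A -> ideal_gen (monomials B) = L -> B = A.

Definition minimal_generator L (m : 'X_{1..s}) : Prop :=
  exists2 A, minimal_generating_set L A & A m.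

(* The value 0 is junk for ideals L without a minimal monomial generator (the
   zero ideal and the ideals that are not monomial). *)
Definition alpha L : nat :=
  xget 0%N [set d | (exists2 m, minimal_generator L m & mdeg m = d) /\
                    forall m, minimal_generator L m -> (d <= mdeg m)%N].

Definition waldschmidt (R : realType) L : R :=
  limn (fun n : nat => (alpha (symbolic_power L n))%:R / n%:R : R).

End MonomialIdeals.

Section Graphs.
Variables (s : nat) (e : rel 'I_s).
Implicit Types D : {set 'I_s}.

Definition bipartite : Prop :=
  exists V1 : {set 'I_s}, forall i j, e i j -> (i \in V1) != (j \in V1).

Definition vertex_cover D : bool :=
  [forall i, forall j, e i j ==> (i \in D) || (j \in D)].

Definition minimal_vertex_cover D : bool := minset vertex_cover D.

Variable K : fieldType.

Definition edge_ideal : set {mpoly K[s]} :=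
  ideal_gen [set f | exists i j, e i j /\ f = 'X_i * 'X_j].

Definition cover_ideal : set {mpoly K[s]} :=
  ideal_gen [set f | exists2 D, minimal_vertex_cover D &
                       f = \prod_(i in D) 'X_i].

End Graphs.

Arguments edge_ideal {s} e K _.
Arguments cover_ideal {s} e K _.

(* Main.v *)
Require Import Defs.
From mathcomp Require Import all_boot all_order all_algebra.
From mathcomp Require Import ring_quotient fraction.
From mathcomp Require Import mpoly.
From mathcomp Require Import boolp classical_sets reals topology normedtype.
From mathcomp Require Import sequences.
Local Open Scope classical_set_scope.
Local Open Scope ring_scope.

(** Let H be a family of subsets of the variables, I_H the ideal generated by
    the squarefree monomials of the members of H, and for a set D of variables
    let P_D be the prime ideal generated by D.  A prime containing I_H contains
    a variable of every member of H, so the minimal primes of I_H are the P_D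
    with D a minimal transversal of H (minimal_primes_sqfree).  If D is a
    minimal transversal, every variable of D is the only one of D in some
    member of H, so I_H and P_D agree after localization at P_D
    (var_pow_localized); and the powers of P_D are primary (var_pow_primary).
    Hence the n-th symbolic power of I_H is spanned by the monomials of degree
    at least n in the variables of D, for every transversal D
    (symbolic_power_sqfree).

    The edge ideal is I_H for H the edges, whose transversals are the vertex
    covers.  The ideal of covers is I_H for H the minimal vertex covers, of
    which every edge is a transversal.  If a vertex cover D contained no edge,
    D and its complement would be a bipartition; so when the graph is not
    bipartite each vertex cover contains an edge (cover_contains_edge).  A
    monomial of degree at least n in the two ends of each edge then has degree
    at least n in the vertices of each cover, which is the inclusion of the
    symbolic powers.

    For the Waldschmidt constants, alpha of a nonzero monomial ideal is the
    least degree of a monomial in it (alpha_monspan), so alpha reverses inclusions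
    between such ideals.  The inequality between the two quotients alpha / n passes to
    the limit because both sequences converge: the monomial description makes
    n |-> alpha(I_H^(n)) subadditive, and the quotients of a subadditive
    sequence converge (subadditive_cvg, which is Fekete's lemma). *)

Set Implicit Arguments.
Unset Strict Implicit.
Unset Printing Implicit Defensive.
Import Order.TTheory GRing.Theory Num.Theory.
Import numFieldNormedType.Exports.

(** * Ideals, their powers and primes *)

Section IdealClosure.
Variable R : comNzRingType.
Implicit Types A I : set R.

Definition is_ideal I : Prop :=
  [/\ I 0, forall x y, I x -> I y -> I (x + y) & forall a x, I x -> I (a * x)].

Lemma is_ideal_sum I (T : Type) (r : seq T) (P : pred T) (F : T -> R) :
  is_ideal I -> (forall i, P i -> I (F i)) -> I (\sum_(i <- r | P i) F i).
Proof. by case=> I0 ID _ IF; apply: (big_ind I). Qed.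

Lemma ideal_gen_sub A I : is_ideal I -> A `<=` I -> ideal_gen A `<=` I.
Proof.
move=> idI sAI _ [k [b [a [_ Aa ->]]]]; apply: is_ideal_sum => // i _.
by case: idI => _ _; apply; apply: sAI.
Qed.

Lemma ideal_genM A a x : A x -> ideal_gen A (a * x).
Proof.
by move=> Ax; exists 1%N, (fun=> a), (fun=> x); split=> //; rewrite big_ord1.
Qed.

Lemma ideal_gen_incl A : A `<=` ideal_gen A.
Proof. by move=> x Ax; rewrite -[x]mul1r; apply: ideal_genM. Qed.

Lemma ideal_gen_is_ideal A : is_ideal (ideal_gen A).
Proof.
split.
- exists 0%N, (fun=> 0), (fun=> 0).
  by split; rewrite ?big_ord0 //; case.
- move=> _ _ [k [b [a [_ Aa ->]]]] [l [c [d [_ Ad ->]]]].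
  exists (k + l)%N.
  exists (fun i => match fintype.split i with inl j => b j | inr j => c j end).
  exists (fun i => match fintype.split i with inl j => a j | inr j => d j end).
  split=> // [i|]; first by case: fintype.split.
  rewrite big_split_ord /=; congr (_ + _); apply: eq_bigr => i _.
    by rewrite (unsplitK (inl _ i)).
  by rewrite (unsplitK (inr _ i)).
- move=> x _ [k [b [a [_ Aa ->]]]]; exists k, (fun i => x * b i), a; split=> //.
  by rewrite big_distrr /=; apply: eq_bigr => i _; rewrite mulrA.
Qed.

Lemma ideal_pow_is_ideal I n : is_ideal (ideal_pow I n).
Proof. exact: ideal_gen_is_ideal. Qed.

Lemma ideal_colon I c : is_ideal I -> is_ideal [set x | I (c * x)].
Proof.
case=> I0 ID IM; split=> [|x y Ix Iy|a x Ix] /=; first by rewrite mulr0.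
  by rewrite mulrDr; apply: ID.
by rewrite mulrCA; apply: IM.
Qed.

Lemma ideal_pow0 I x : ideal_pow I 0 x.
Proof.
rewrite -[x]mulr1; apply: ideal_genM; exists (fun=> 0); first by case.
by rewrite big_ord0.
Qed.

Lemma ideal_powSM I n x y :
  I x -> ideal_pow I n y -> ideal_pow I n.+1 (x * y).
Proof.
move=> Ix; move: y; apply: ideal_gen_sub.
  exact/ideal_colon/ideal_pow_is_ideal.
move=> _ [a Ia ->]; apply: ideal_gen_incl.
exists (fun i => if unlift ord0 i is Some j then a j else x).
  by move=> i; case: unlift.
rewrite big_ord_recl unlift_none; congr (_ * _).
by apply: eq_bigr => i _; rewrite liftK.
Qed.

Section Prime.
Variable p : set R.
Hypothesis p_prime : prime_ideal p.

Lemma prime_ideal_is_ideal : is_ideal p.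
Proof.
have [[p0 p1 pD] _] := p_prime.
have {}p0 : p 0 by rewrite -[p 0](in_setE p); exact: p0.
have {}pD a x y : p x -> p y -> p (a * x + y).
  by move=> px py; rewrite -[p _](in_setE p); apply: pD; apply/mem_set.
split=> // [x y px py|a x px]; first by rewrite -[x]mul1r; apply: pD.
by rewrite -[_ * _]addr0; apply: pD.
Qed.

Lemma prime_ideal1 : ~ p 1.
Proof. by have [[_ + _] _] := p_prime; rewrite inE => /negP + /mem_set. Qed.

Lemma prime_idealM x y : p (x * y) -> p x \/ p y.
Proof.
have [_ pM] := p_prime => /mem_set /pM.
by rewrite !inE => /orP[] /set_mem; [left|right].
Qed.

Lemma prime_ideal_prod (T : Type) (r : seq T) (P : pred T) (F : T -> R) :
  (forall i, P i -> ~ p (F i)) -> ~ p (\prod_(i <- r | P i) F i).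
Proof.
move=> pF; apply: (big_ind (fun x => ~ p x)) => //; first exact: prime_ideal1.
by move=> x y px py /prime_idealM[].
Qed.

Lemma prime_ideal_exp x n : ~ p x -> ~ p (x ^+ n).
Proof.
move=> px; elim: n => [|n IHn]; first exact: prime_ideal1.
by rewrite exprS => /prime_idealM[].
Qed.

End Prime.

Lemma prime_idealI p : is_ideal p -> ~ p 1 ->
  (forall x y, p (x * y) -> ~ p y -> p x) -> prime_ideal p.
Proof.
case=> p0 pD pM p1 pP.
have pE x : (x \in [pred x | x \in p]) = `[< p x >] by [].
split=> [|x y]; last first.
  rewrite !pE => /asboolP pxy; apply/orP.
  by have [py|py] := EM (p y); [right|left]; apply/asboolP => //; apply: pP py.
split=> [||a x y]; rewrite !pE; [exact/asboolP|exact/asboolPn|].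
by move=> /asboolP px /asboolP py; apply/asboolP/pD => //; apply: pM.
Qed.

End IdealClosure.

(** * Contraction from a localization *)

Section Localization.
Variable R : idomainType.
Implicit Types p J : set R.

(** Clearing the denominators of a fraction whose numerator lies in J. *)
Lemma loc_contractionP p J f : prime_ideal p -> is_ideal J ->
  loc_contraction J p f <-> exists2 d, ~ p d & J (d * f).
Proof.
move=> p_prime idJ; have [J0 JD JM] := idJ.
have [p0 _ _] := prime_ideal_is_ideal p_prime.
have nz d : ~ p d -> tofrac d != 0.
  by move=> pd; rewrite tofrac_eq0; apply/eqP => d0; apply: pd; rewrite d0.
split=> [[k [b [a [bP aP fE]]]]|[d pd Jdf]]; last first.
  exists 1%N, (fun=> tofrac 1 / tofrac d), (fun=> tofrac (d * f)).
  split=> [_|_|]; [by exists 1, d|by exists (d * f)|].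
  by rewrite big_ord1 tofrac1 mul1r tofracM mulKf ?nz.
suff [d pd [g Jg /eqP]] : exists2 d, ~ p d &
    exists2 g, J g & tofrac d * (\sum_(i < k) b i * a i) = tofrac g.
  by rewrite -fE -tofracM tofrac_eq => /eqP dfE; exists d => //; rewrite dfE.
elim: k b a bP aP {f fE} => [|k IHk] b a bP aP.
  exists 1; first exact: prime_ideal1.
  by exists 0 => //; rewrite big_ord0 mulr0 tofrac0.
have [d pd [g Jg dE]] := IHk (b \o lift ord0) (a \o lift ord0)
  (fun i => bP _) (fun i => aP _).
have [c [e [pe bE]]] := bP ord0; have [h Jh aE] := aP ord0.
(* the common denominator, and the numerators brought over it *)
exists (e * d); first by case/(prime_idealM p_prime).
exists (d * c * h + e * g); first by apply: JD; apply: JM.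
rewrite big_ord_recl mulrDr tofracD !tofracM; congr (_ + _).
  rewrite bE -aE [_ * tofrac d]mulrC -!mulrA; congr (_ * _).
  by rewrite mulrCA mulVKf ?nz.
by rewrite -mulrA dE.
Qed.

End Localization.

(** * Monomial ideals and powers of monomial primes *)

Section MonomialSpan.
Variables (s : nat) (K : fieldType).
Implicit Types (U V : set 'X_{1..s}) (f g : {mpoly K[s]}) (D E : {set 'I_s}).

(** Monomial ideals are described by the set U of their monomials; this makes
    inclusions between them inclusions between sets of exponents. *)
Definition monspan U : set {mpoly K[s]} :=
  [set f | forall m, m \in msupp f -> U m].

Definition upclosed U : Prop := forall m m', (m <= m')%MM -> U m -> U m'.

Lemma monspanX U m : monspan U 'X_[m] <-> U m.
Proof.
split=> [|Um k]; first by apply; rewrite msuppX mem_seq1.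
by rewrite msuppX mem_seq1 => /eqP ->.
Qed.

Lemma monspan_is_ideal U : upclosed U -> is_ideal (monspan U).
Proof.
move=> upU; split=> [m|f g Uf Ug m /msuppD_le|g f Uf m /msuppM_le].
- by rewrite msupp0.
- by rewrite mem_cat => /orP[/Uf|/Ug].
- case/allpairsP=> -[m1 m2] [/= _ /Uf Um2 ->].
  by apply: upU Um2; apply: lem_addl.
Qed.

Lemma monspan_sub U (J : set {mpoly K[s]}) :
  is_ideal J -> (forall m, U m -> J 'X_[m]) -> monspan U `<=` J.
Proof.
move=> idJ UJ f Uf; rewrite [f]mpolyE big_seq.
apply: is_ideal_sum => // m /Uf Um; have [_ _ JM] := idJ.
by rewrite -mul_mpolyC; apply: JM; apply: UJ.
Qed.

Definition wdeg D (m : 'X_{1..s}) : nat := (\sum_(i in D) m i)%N.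

Lemma wdegD D m1 m2 : wdeg D (m1 + m2)%MM = (wdeg D m1 + wdeg D m2)%N.
Proof. by rewrite -big_split; apply: eq_bigr => i _; rewrite mnmDE. Qed.

Lemma wdegU D i : wdeg D U_(i)%MM = (i \in D).
Proof.
rewrite /wdeg; under eq_bigr do rewrite mnm1E.
case: (boolP (i \in D)) => iD.
  rewrite (bigD1 i) //= eqxx big1 // => j /andP[_ /negbTE].
  by rewrite eq_sym => ->.
by rewrite big1 // => j jD; case: eqP => // ij; rewrite ij jD in iD.
Qed.

Lemma wdeg_le D m m' : (m <= m')%MM -> (wdeg D m <= wdeg D m')%N.
Proof. by move=> /mnm_lepP mm'; apply: leq_sum. Qed.

Lemma wdeg_subset D E m : D \subset E -> (wdeg D m <= wdeg E m)%N.
Proof.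
by move=> DE; rewrite /wdeg [leqRHS](big_setID D) /= (finset.setIidPr DE) leq_addr.
Qed.

Lemma wdeg_gt0 D m : (0 < wdeg D m)%N -> exists2 i, i \in D & (U_(i) <= m)%MM.
Proof.
rewrite lt0n sum_nat_eq0 => /forallPn[i].
by rewrite negb_imply => /andP[iD mi]; exists i; rewrite ?lep1mP.
Qed.

(** The n-th power of the prime ideal generated by the variables in D: a
    monomial is a product of n of these variables and another monomial exactly
    when its degree in D is at least n. *)
Definition var_pow D n : set {mpoly K[s]} := monspan [set m | (n <= wdeg D m)%N].

Lemma var_pow_upclosed D n : upclosed [set m | (n <= wdeg D m)%N].
Proof. by move=> m m' mm' /= /leq_trans; apply; apply: wdeg_le. Qed.

Lemma var_pow_is_ideal D n : is_ideal (var_pow D n).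
Proof. exact: monspan_is_ideal (@var_pow_upclosed D n). Qed.

Lemma var_powM D k n f g :
  var_pow D k f -> var_pow D n g -> var_pow D (k + n) (f * g).
Proof.
move=> kf ng m /msuppM_le /allpairsP[[m1 m2] [/= /kf k1 /ng n2 ->]].
by rewrite wdegD leq_add.
Qed.

Lemma var_pow_ideal_pow D (J : set {mpoly K[s]}) n :
  J `<=` var_pow D 1 -> ideal_pow J n `<=` var_pow D n.
Proof.
move=> JD; apply: ideal_gen_sub; first exact: var_pow_is_ideal.
move=> _ [a Ja ->]; elim: n a Ja => [|n IHn] a Ja; first by move=> m _ /=.
by rewrite big_ord_recl; apply: (@var_powM D 1 n); [apply: JD | apply: IHn].
Qed.

(** The substitution X_i |-> X_i T for i in D, which fixes the other variables:
    the coefficient of T^k is the component of degree k in the variables of D. *)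
Definition grading D : {mpoly K[s]} -> {poly {mpoly K[s]}} :=
  mmap (polyC \o @mpolyC s K) (fun i => ('X_i : {mpoly K[s]})%:P * 'X^(i \in D)).

Lemma grading_coef D f k m :
  ((grading D f)`_k)@_m = if wdeg D m == k then f@_m else 0.
Proof.
rewrite /grading /mmap coef_sum raddf_sum [in RHS](mpolyE f) raddf_sum /=.
rewrite (eq_bigr (fun m' => if wdeg D m == k then f@_m' * 'X_[m']@_m else 0)).
  by case: ifP => _; [apply: eq_bigr => i _; rewrite mcoeffZ | rewrite big1_eq].
move=> m' _.
have -> : mmap1 (fun i : 'I_s => ('X_i : {mpoly K[s]})%:P * 'X^(i \in D)) m' =
    'X_[K, m']%:P * 'X^(wdeg D m').
  rewrite /mmap1 (eq_bigr (fun i => ('X_i ^+ m' i)%:P * 'X^(if i \in D then m' i else 0%N))).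
    rewrite big_split /= -rmorph_prod /= -mpolyXE_id; congr (_ * _).
    by rewrite prodrXr /wdeg [in RHS]big_mkcond.
  move=> i _; rewrite exprMn -rmorphXn /= -exprM.
  by case: (i \in D); rewrite ?mul1n ?mul0n.
rewrite mulrA -polyCM coefCM coefXn mul_mpolyC mcoeffX.
case: (eqVneq m' m) => [->|mm'].
  rewrite mulr1 [k == _]eq_sym; case: eqP => _.
    by rewrite mulr1 mcoeffZ mcoeffX eqxx mulr1.
  by rewrite mulr0 mcoeff0.
rewrite mulr0 if_same; case: (k == _); last by rewrite mulr0 mcoeff0.
by rewrite mulr1 mcoeffZ mcoeffX (negbTE mm') mulr0.
Qed.

Lemma var_pow_grading D n f :
  var_pow D n f <-> forall k, (k < n)%N -> (grading D f)`_k = 0.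
Proof.
split=> [fn k kn|fn m mf].
  apply/mpolyP => m; rewrite grading_coef mcoeff0; case: eqP => // mk.
  apply/eqP; rewrite mcoeff_eq0; apply/negP => /fn /=.
  by rewrite mk leqNgt kn.
rewrite /= leqNgt; apply/negP => /fn /(congr1 (mcoeff m)) /eqP.
by rewrite grading_coef eqxx mcoeff0 mcoeff_eq0 mf.
Qed.

(** The n-th power of P_D consists of the f whose grading is divisible by T^n,
    and T is prime in a polynomial ring over a domain: if the constant
    coefficient of the grading of g is not 0, the coefficients of the grading
    of f vanish one after the other below n. *)
Lemma var_pow_primary D n f g :
  var_pow D n (f * g) -> ~ var_pow D 1 g -> var_pow D n f.
Proof.
move=> /var_pow_grading fgn ng1; apply/var_pow_grading.
have g0 : (grading D g)`_0 != 0.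
  by apply/eqP => g0; apply/ng1/var_pow_grading => -[].
elim/ltn_ind => k IHk kn; have := fgn _ kn.
rewrite /grading rmorphM coefM big_ord_recr subnn big1 /= => [|i _]; last first.
  by rewrite [X in X * _](IHk i) ?mul0r // (ltn_trans _ kn).
by rewrite add0r => /eqP; rewrite mulf_eq0 (negbTE g0) orbF => /eqP.
Qed.

Lemma var_pow_prime D : prime_ideal (var_pow D 1).
Proof.
apply: prime_idealI; first exact: var_pow_is_ideal.
  by rewrite -mpolyX0 => /monspanX /=; rewrite /wdeg big1 // => i _; rewrite mnm0E.
by move=> f g; apply: var_pow_primary.
Qed.

Lemma var_pow1X D i : var_pow D 1 'X_i <-> i \in D.
Proof. by rewrite /var_pow monspanX /= wdegU; case: (i \in D). Qed.

Lemma var_pow1_sub D (J : set {mpoly K[s]}) :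
  is_ideal J -> (forall i, i \in D -> J 'X_i) -> var_pow D 1 `<=` J.
Proof.
move=> idJ DJ; apply: monspan_sub => // m /wdeg_gt0[i iD im].
by have [_ _ JM] := idJ; rewrite -(submK im) mpolyXD; apply/JM/DJ.
Qed.

End MonomialSpan.

Arguments monspan {s} K U _.
Arguments var_pow {s} K D n _.

(** * Symbolic powers of squarefree monomial ideals *)

Section SquarefreeIdeals.
Variables (s : nat) (K : fieldType) (H : pred {set 'I_s}).
Implicit Types (C D E : {set 'I_s}) (q : set {mpoly K[s]}) (f : {mpoly K[s]}).

Definition transversal D : bool := [forall C, H C ==> [exists i in C, i \in D]].

Lemma transversalP D :
  reflect (forall C, H C -> exists2 i, i \in C & i \in D) (transversal D).
Proof.
apply: (iffP forallP) => tD C.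
  by move=> HC; have := tD C; rewrite HC => /exists_inP.
by apply/implyP => /tD ?; apply/exists_inP.
Qed.

Definition sqfree_ideal : set {mpoly K[s]} :=
  ideal_gen [set f | exists2 C, H C & f = \prod_(i in C) 'X_i].

Definition symbolic_monomials n : set 'X_{1..s} :=
  [set m | forall D, transversal D -> (n <= wdeg D m)%N].

Lemma sqfree_ideal_sub_var D : transversal D -> sqfree_ideal `<=` var_pow K D 1.
Proof.
move=> /transversalP tD; apply: ideal_gen_sub; first exact: var_pow_is_ideal.
move=> _ [C /tD[i iC iD] ->]; rewrite (bigD1 i) //= mulrC.
by have [_ _] := var_pow_is_ideal K D 1; apply; apply/var_pow1X.
Qed.

(** The transversal is the set of the variables in q: since q is prime, it
    contains a factor of each generator. *)
Lemma prime_transversal q : prime_ideal q -> sqfree_ideal `<=` q ->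
  exists2 E, transversal E & var_pow K E 1 `<=` q.
Proof.
move=> q_prime Iq; pose E := [set i | `[< q 'X_i >]]%SET.
have EP i : (i \in E) = `[< q 'X_i >] by rewrite inE.
exists E.
  apply/transversalP => C HC; apply: contrapT => CE.
  have : q (\prod_(i in C) 'X_i) by apply/Iq/ideal_gen_incl; exists C.
  apply: prime_ideal_prod => // i iC qi; apply: CE.
  by exists i => //; rewrite EP; apply/asboolP.
apply: var_pow1_sub; first exact: prime_ideal_is_ideal.
by move=> i; rewrite EP => /asboolP.
Qed.

Lemma var_pow1_subset D E : var_pow K D 1 `<=` var_pow K E 1 -> D \subset E.
Proof.
move=> DE; apply/fintype.subsetP => i iD.
by apply/(var_pow1X K)/DE/var_pow1X.
Qed.

Lemma minimal_primes_sqfree q :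
  minimal_primes sqfree_ideal q <->
  exists2 D, minset transversal D & q = var_pow K D 1.
Proof.
split=> [[q_prime Iq qmin]|[D /minsetP[tD Dmin] ->]].
  have [E tE Eq] := prime_transversal q_prime Iq.
  have PEq D : transversal D -> var_pow K D 1 `<=` q -> var_pow K D 1 = q.
    by move=> tD; apply: qmin; [exact: var_pow_prime|exact: sqfree_ideal_sub_var].
  exists E; last by rewrite PEq.
  apply/minsetP; split=> // D tD DE; apply/eqP; rewrite finset.eqEsubset DE /=.
  apply: var_pow1_subset; rewrite (PEq E) // -(PEq D) // => f Df.
  apply: Eq => m /Df /= Dm; exact: leq_trans Dm (wdeg_subset _ DE).
split; [exact: var_pow_prime|exact: sqfree_ideal_sub_var|].
move=> p p_prime Ip pD; have [E tE Ep] := prime_transversal p_prime Ip.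
apply/seteqP; split=> //; rewrite -(Dmin E tE) //.
by apply: var_pow1_subset => f /Ep /pD.
Qed.

(** Since D minus i is not a transversal, some member C of H meets D in i
    alone; u is the product of the other variables of C. *)
Lemma minimal_transversal_unit D i : minset transversal D -> i \in D ->
  exists2 u : {mpoly K[s]}, ~ var_pow K D 1 u & sqfree_ideal (u * 'X_i).
Proof.
move=> /minsetP[/transversalP tD Dmin] iD.
have [C HC Ci] : exists2 C, H C & forall j, j \in C -> j \in D -> j = i.
  apply: contrapT => noC; have := setD11 i D.
  rewrite (Dmin (D :\ i)%SET) ?iD ?subD1set //.
  apply/transversalP => C HC; apply: contrapT => CD; apply: noC.
  exists C => // j jC jD; apply: contrapT => /eqP ji.
  by apply: CD; exists j => //; rewrite in_setD1 ji.
have [j jC jD] := tD C HC; have ji := Ci j jC jD; rewrite {j}ji in jC jD.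
exists (\prod_(j in C | j != i) 'X_j).
  apply: prime_ideal_prod; first exact: var_pow_prime.
  by move=> j /andP[jC' ji] /var_pow1X /(Ci _ jC') /eqP; rewrite (negbTE ji).
by apply: ideal_gen_incl; exists C => //; rewrite mulrC [in RHS](bigD1 i).
Qed.

(** The ideal and the prime agree after localization at a minimal prime: the
    product u of the multipliers of the variables of D is invertible there, and
    u X_i lies in the ideal for every i in D. *)
Lemma var_pow_localized D : minset transversal D ->
  exists2 u : {mpoly K[s]}, ~ var_pow K D 1 u &
    forall n, var_pow K D n `<=` [set f | ideal_pow sqfree_ideal n (u ^+ n * f)].
Proof.
move=> minD.
have [_ _ IM] : is_ideal sqfree_ideal by exact: ideal_gen_is_ideal.
have /boolp.choice[u uP] : forall i, exists ui : {mpoly K[s]}, i \in D ->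
    ~ var_pow K D 1 ui /\ sqfree_ideal (ui * 'X_i).
  move=> i; case: (boolP (i \in D)) => [iD|_]; last by exists 0.
  by have [ui] := minimal_transversal_unit minD iD; exists ui.
exists (\prod_(i in D) u i).
  apply: prime_ideal_prod; first exact: var_pow_prime.
  by move=> i /uP[].
set v := \prod_(i in D) u i => n.
have vI i : i \in D -> sqfree_ideal (v * 'X_i).
  move=> iD; rewrite /v (bigD1 i) //= mulrAC mulrC.
  by apply: IM; have [] := uP i iD.
apply: monspan_sub; first exact/ideal_colon/ideal_pow_is_ideal.
elim: n => [m _|n IHn m /= nm]; first exact: ideal_pow0.
(* peel off a variable of D from the monomial, together with one factor v *)
have [i iD im] : exists2 i, i \in D & (U_(i) <= m)%MM.
  by apply: wdeg_gt0; apply: leq_ltn_trans nm.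
have {}IHn : ideal_pow sqfree_ideal n (v ^+ n * 'X_[m - U_(i)]).
  apply: IHn; rewrite /= -ltnS -add1n; apply: leq_trans nm _.
  by rewrite -{1}(submK im) wdegD wdegU iD addn1.
rewrite -(submK im) mpolyXD exprS ['X_[_] * _]mulrC mulrACA.
by apply: ideal_powSM => //; apply: vI.
Qed.

(** At the minimal prime P_D the contraction is the n-th power of P_D.  The
    minimal transversals give the same condition on monomials as all of them,
    because the degree in D grows with D. *)
Theorem symbolic_power_sqfree n :
  symbolic_power sqfree_ideal n = monspan K (symbolic_monomials n).
Proof.
apply/seteqP; split=> f.
  move=> fn m mf D tD; have [E minE ED] := minset_exists tD.
  have tE := minsetp minE; apply: leq_trans (wdeg_subset m ED).
  have : minimal_primes sqfree_ideal (var_pow K E 1).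
    by apply/minimal_primes_sqfree; exists E.
  move/fn/(loc_contractionP _ (var_pow_prime K E) (ideal_gen_is_ideal _)).
  case=> d Ed /(var_pow_ideal_pow (sqfree_ideal_sub_var tE)).
  by rewrite mulrC => /var_pow_primary /(_ Ed m mf).
move=> fn _ /minimal_primes_sqfree[D minD ->].
apply/(loc_contractionP _ (var_pow_prime K D) (ideal_gen_is_ideal _)).
have [u Du uP] := var_pow_localized minD; exists (u ^+ n).
  by apply: prime_ideal_exp => //; apply: var_pow_prime.
by apply: uP => m mf; apply: fn => //; apply: minsetp minD.
Qed.

End SquarefreeIdeals.

Arguments sqfree_ideal {s} K H _.

(** * The least degree of a generator *)

Section InitialDegree.
Variables (s : nat) (K : fieldType).
Implicit Types (U A : set 'X_{1..s}) (m : 'X_{1..s}).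

Lemma mdeg_lt m m' : (m' <= m)%MM -> m' <> m -> (mdeg m' < mdeg m)%N.
Proof.
move=> mm' ne; have := mdegD (m - m') m'; rewrite submK // => ->.
rewrite -[ltnLHS]add0n ltn_add2r lt0n mdeg_eq0.
by apply/eqP => d0; apply: ne; have := submK mm'; rewrite d0 add0m.
Qed.

Definition min_monomials U : set 'X_{1..s} :=
  [set m | U m /\ forall m', U m' -> (m' <= m)%MM -> m' = m].

Lemma min_monomials_below U m : U m ->
  exists2 m', min_monomials U m' & (m' <= m)%MM.
Proof.
have [k] := ubnP (mdeg m); elim: k m => // k IHk m mk Um.
have [mmin|] := EM (min_monomials U m); first by exists m => //; apply: lepm_refl.
move=> nmin; have [m' [Um' mm' ne]] : exists m', [/\ U m', (m' <= m)%MM & m' <> m].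
  apply: contrapT => none; apply: nmin; split=> // m' Um' mm'.
  by apply: contrapT => ne; apply: none; exists m'.
have [|m'' min'' le''] := IHk m' _ Um'.
  by apply: leq_trans (mdeg_lt mm' ne) _.
by exists m'' => //; apply: lepm_trans mm'.
Qed.

Lemma monomial_in_gen A m :
  ideal_gen (@monomials s K A) 'X_[m] -> exists2 a, A a & (a <= m)%MM.
Proof.
have upA : upclosed [set k | exists2 a, A a & (a <= k)%MM].
  by move=> k l kl [a Aa ak]; exists a => //; apply: lepm_trans kl.
move=> /(ideal_gen_sub (monspan_is_ideal K upA)) => /(_ _)/monspanX; apply.
by move=> _ [a Aa <-]; apply/monspanX; exists a => //; apply: lepm_refl.
Qed.

Lemma monspan_gen U : upclosed U ->
  ideal_gen (@monomials s K (min_monomials U)) = monspan K U.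
Proof.
move=> upU; apply/seteqP; split.
  apply: ideal_gen_sub; first exact: monspan_is_ideal.
  by move=> _ [m [Um _] <-]; apply/monspanX.
apply: monspan_sub; first exact: ideal_gen_is_ideal.
move=> m /min_monomials_below[m' min' le']; rewrite -(submK le') mpolyXD.
by apply: ideal_genM; exists m'.
Qed.

(** A monomial of a monomial ideal is a multiple of one of any given monomial
    generators, so a minimal monomial occurs in every generating set. *)
Lemma min_monomials_generating U : upclosed U ->
  minimal_generating_set (monspan K U) (min_monomials U).
Proof.
move=> upU; split; first exact: monspan_gen.
move=> B BU BE; apply/seteqP; split=> // m minm.
have [b Bb bm] : exists2 b, B b & (b <= m)%MM.
  by apply: monomial_in_gen; rewrite BE; apply/monspanX; case: minm.
by case: minm => _ /(_ b) <- //; case: (BU b Bb).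
Qed.

(** A monomial of least degree is minimal for divisibility, hence is a minimal
    generator. *)
Lemma alpha_monspan U m : upclosed U -> U m ->
  (forall k, U k -> (mdeg m <= mdeg k)%N) -> alpha (monspan K U) = mdeg m.
Proof.
move=> upU Um mmin.
have mgen : minimal_generator (monspan K U) m.
  exists (min_monomials U); first exact: min_monomials_generating.
  split=> // k Uk km; apply: contrapT => ne.
  by have := mdeg_lt km ne; rewrite ltnNge mmin.
have genU k : minimal_generator (monspan K U) k -> U k.
  move=> [A [AE _] Ak]; apply/(monspanX K); rewrite -AE.
  by apply: ideal_gen_incl; exists k.
rewrite /alpha; case: xgetP => [d _ [[k kgen <-] dmin]|none].
  by apply/eqP; rewrite eqn_leq dmin // mmin //; apply: genU.
case: (none (mdeg m)); split; first by exists m.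
by move=> k /genU /mmin.
Qed.

Lemma alpha_monspanP U : upclosed U -> (exists m, U m) ->
  (exists2 m, U m & mdeg m = alpha (monspan K U)) /\
  (forall m, U m -> (alpha (monspan K U) <= mdeg m)%N).
Proof.
move=> upU [m0 Um0].
have exd : exists d, `[< exists2 m, U m & mdeg m = d >].
  by exists (mdeg m0); apply/asboolP; exists m0.
have [d /asboolP[m Um md] dmin] := ex_minnP exd.
have mmin k : U k -> (mdeg m <= mdeg k)%N.
  by move=> Uk; rewrite md; apply: dmin; apply/asboolP; exists k.
by rewrite (alpha_monspan upU Um mmin); split=> //; exists m.
Qed.

End InitialDegree.

(** * Subadditive sequences *)

Section Fekete.
Variables (R : realType) (a : nat -> nat).
Hypothesis a_sub : forall m n, (a (m + n) <= a m + a n)%N.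

Lemma subadditive_mul q k : (0 < q)%N -> (a (q * k) <= q * a k)%N.
Proof.
case: q => // q _; elim: q => [|q IHq]; first by rewrite !mul1n.
by rewrite mulSn [leqRHS]mulSn (leq_trans (a_sub _ _)) // leq_add2l.
Qed.

(** Euclidean division n = q k + r; the last summand bounds a r for all r < k.
    The term a 0 accounts for r = 0. *)
Lemma subadditive_bound k n : (0 < k)%N -> (0 < n)%N ->
  (a n <= n %/ k * a k + (a 0 + k * a 1))%N.
Proof.
move=> k0 n0.
have small r : (a r <= a 0 + r * a 1)%N.
  elim: r => [|r IHr]; first by rewrite mul0n addn0.
  by rewrite -addn1 (leq_trans (a_sub _ _)) // addn1 mulSnr addnA leq_add2r.
have rk : (a (n %% k) <= a 0 + k * a 1)%N.
  by rewrite (leq_trans (small _)) // leq_add2l leq_mul2r ltnW ?orbT // ltn_pmod.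
have [q0|q0] := posnP (n %/ k).
  by rewrite [n in a n](divn_eq n k) q0 mul0n add0n mul0n add0n.
rewrite [n in a n](divn_eq n k) (leq_trans (a_sub _ _)) // leq_add //.
exact: subadditive_mul.
Qed.

(** The limit is the infimum of the quotients: if a k / k is close to it, the
    bound above divided by n is a k / k plus a term that tends to 0. *)
Lemma subadditive_cvg : cvgn (fun n => (a n)%:R / n%:R : R).
Proof.
pose u n : R := (a n)%:R / n%:R.
pose E := [set x | exists2 k, (0 < k)%N & x = u k].
have u0 n : 0 <= u n by rewrite divr_ge0.
have infE : has_inf E.
  split; first by exists (u 1%N), 1%N.
  by exists 0 => _ [k _ ->].
apply/cvg_ex; exists (inf E); apply/cvgrPdist_lt => eps eps0.
have [_ [k k0 ->] ukE] := inf_adherent (divr_gt0 eps0 (ltr0Sn R 1)) infE.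
near=> n.
have n0 : (0 < n)%N by near: n; exact: nbhs_infty_gt.
have uE : inf E <= u n by apply: ge_inf; [case: infE|exists n].
rewrite distrC ger0_norm ?subr_ge0 // ltrBlDl.
have un : u n <= u k + (a 0 + k * a 1)%N%:R / n%:R.
  rewrite ler_pdivrMr ?ltr0n // mulrDl divfK ?pnatr_eq0 -?lt0n //.
  apply: le_trans (_ : (n %/ k * a k + (a 0 + k * a 1))%N%:R <= _).
    by rewrite ler_nat subadditive_bound.
  rewrite natrD lerD2r natrM mulrC /u -mulrA ler_wpM2l //.
  rewrite mulrC ler_pdivlMr ?ltr0n // -natrM ler_nat; exact: leq_trunc_div.
apply: le_lt_trans un _; rewrite [eps]splitr addrA ltrD //.
rewrite ltr_pdivrMr ?ltr0n // mulrC -ltr_pdivrMr ?divr_gt0 //.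
by near: n; apply: nbhs_infty_gtr.
Unshelve. all: by end_near. Qed.

End Fekete.

(** * Waldschmidt constants of squarefree monomial ideals *)

Section WaldschmidtConstants.
Variables (s : nat) (K : fieldType) (H : pred {set 'I_s}).

Lemma symbolic_monomials_upclosed n : upclosed (symbolic_monomials H n).
Proof. by move=> m m' mm' Hm D /Hm /leq_trans; apply; apply: wdeg_le. Qed.

Lemma symbolic_monomialsD m n k l : symbolic_monomials H m k ->
  symbolic_monomials H n l -> symbolic_monomials H (m + n) (k + l)%MM.
Proof. by move=> Hk Hl D tD; rewrite wdegD leq_add ?Hk ?Hl. Qed.

(** As H has a member, its transversals are not empty and the n-th power of the
    product of all variables has degree at least n in each of them. *)
Lemma symbolic_monomials_ex C n : H C -> exists m, symbolic_monomials H n m.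
Proof.
move=> HC; exists [multinom n | i < s] => D /transversalP /(_ C HC)[i _ iD].
by rewrite /wdeg (bigD1 i) //= mnmE leq_addr.
Qed.

Lemma alpha_symbolicP C n : H C ->
  (exists2 m, symbolic_monomials H n m &
     mdeg m = alpha (symbolic_power (sqfree_ideal K H) n)) /\
  (forall m, symbolic_monomials H n m ->
     (alpha (symbolic_power (sqfree_ideal K H) n) <= mdeg m)%N).
Proof.
move=> /(symbolic_monomials_ex n); rewrite symbolic_power_sqfree.
exact/alpha_monspanP/symbolic_monomials_upclosed.
Qed.

(** The product of a monomial of the m-th symbolic power and one of the n-th
    lies in the (m+n)-th, so the least degrees are subadditive. *)
Lemma waldschmidt_cvg (R : realType) C : H C ->
  cvgn (fun n => (alpha (symbolic_power (sqfree_ideal K H) n))%:R / n%:R : R).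
Proof.
move=> HC; apply: subadditive_cvg => m n.
have [[k Hk <-] _] := alpha_symbolicP m HC.
have [[l Hl <-] _] := alpha_symbolicP n HC.
have [_ mn_min] := alpha_symbolicP (m + n) HC.
by rewrite -mdegD; apply/mn_min/symbolic_monomialsD.
Qed.

End WaldschmidtConstants.

Section Comparison.
Variables (R : realType) (s : nat) (K : fieldType) (H J : pred {set 'I_s}).
Hypothesis HJ : forall n, symbolic_monomials J n `<=` symbolic_monomials H n.

Lemma symbolic_power_sub n :
  symbolic_power (sqfree_ideal K J) n `<=` symbolic_power (sqfree_ideal K H) n.
Proof. by rewrite !symbolic_power_sqfree => f Jf m /Jf /HJ. Qed.

Lemma waldschmidt_le C E : H C -> J E ->
  waldschmidt R (sqfree_ideal K H) <= waldschmidt R (sqfree_ideal K J).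
Proof.
move=> HC JE; apply: ler_lim; [exact: waldschmidt_cvg HC|exact: waldschmidt_cvg JE|].
apply: nearW => n; rewrite ler_wpM2r ?invr_ge0 // ler_nat.
have [_ n_min] := alpha_symbolicP K n HC.
by have [[m /HJ /n_min Hm <-] _] := alpha_symbolicP K n JE.
Qed.

End Comparison.

(** * Edges and vertex covers *)

Section GraphHypergraphs.
Variables (s : nat) (e : rel 'I_s).
Hypothesis e_irr : irreflexive e.

Definition edges : pred {set 'I_s} :=
  fun C => [exists i, exists j, e i j && (C == [set i; j]%SET)].

Lemma edgesP C : reflect (exists i j, e i j /\ C = [set i; j]%SET) (edges C).
Proof.
apply: (iffP existsP) => [[i /existsP[j /andP[eij /eqP ->]]]|[i [j [eij ->]]]].
  by exists i, j.
by exists i; apply/existsP; exists j; rewrite eij eqxx.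
Qed.

Lemma edge_ideal_sqfree (K : fieldType) : edge_ideal e K = sqfree_ideal K edges.
Proof.
rewrite /edge_ideal /sqfree_ideal; congr ideal_gen.
have prodE i j : e i j ->
    \prod_(k in [set i; j]%SET) 'X_k = 'X_i * 'X_j :> {mpoly K[s]}.
  move=> eij; rewrite finset.big_setU1 ?finset.big_set1 // finset.in_set1.
  by apply/eqP => ij; rewrite ij e_irr in eij.
apply/seteqP; split=> [_ [i [j [eij ->]]]|_ [_ /edgesP[i [j [eij ->]]] ->]] /=.
  by exists [set i; j]%SET; rewrite ?prodE //; apply/edgesP; exists i, j.
by exists i, j; rewrite prodE.
Qed.

Lemma transversal_edges D : transversal edges D = vertex_cover e D.
Proof.
apply/transversalP/forallP => [tD i|cD _ /edgesP[i [j [eij ->]]]].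
  apply/forallP => j; apply/implyP => eij.
  have [|k] := tD [set i; j]%SET; first by apply/edgesP; exists i, j.
  by rewrite !inE => /orP[]/eqP -> ->; rewrite ?orbT.
have /forallP /(_ j) := cD i; rewrite eij => /orP[] kD.
  by exists i => //; rewrite set21.
by exists j => //; rewrite set22.
Qed.

Lemma edge_transversal_covers i j : e i j ->
  transversal (minimal_vertex_cover e) [set i; j]%SET.
Proof.
move=> eij; apply/transversalP => D /minsetp /forallP /(_ i) /forallP /(_ j).
rewrite eij => /orP[] kD; [exists i | exists j] => //; by rewrite !inE eqxx ?orbT.
Qed.

Hypothesis e_nbip : ~ bipartite e.

(** Otherwise D and its complement would both be independent, as a vertex cover
    has an independent complement. *)
Lemma cover_contains_edge D : vertex_cover e D ->
  exists i j, e i j /\ [set i; j]%SET \subset D.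
Proof.
move=> cD; apply: contrapT => noE; apply: e_nbip; exists D => i j eij.
have /forallP /(_ i) /forallP /(_ j) := cD; rewrite eij.
case iD: (i \in D); case jD: (j \in D) => // _; case: noE.
by exists i, j; split=> //; apply/fintype.subsetP => k; rewrite !inE => /orP[]/eqP ->.
Qed.

(** The degree in a cover is at least the degree in an edge inside it. *)
Lemma cover_symbolic_monomials n :
  symbolic_monomials (minimal_vertex_cover e) n `<=` symbolic_monomials edges n.
Proof.
move=> m Jm D; rewrite transversal_edges => /cover_contains_edge[i [j [eij ijD]]].
exact: leq_trans (Jm _ (edge_transversal_covers eij)) (wdeg_subset _ ijD).
Qed.

Lemma vertex_cover_setT : vertex_cover e [set: 'I_s]%SET.
Proof. by apply/forallP => i; apply/forallP => j; rewrite inE implybT. Qed.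

End GraphHypergraphs.

Theorem proposition6p5 (R : realType) (K : fieldType) (s : nat) (e : rel 'I_s)
    (e_sym : ssrbool.symmetric e) (e_irr : irreflexive e) (e_nbip : ~ bipartite e) :
  (forall n : nat, (1 <= n)%N ->
     symbolic_power (cover_ideal e K) n `<=` symbolic_power (edge_ideal e K) n)
  /\ waldschmidt R (edge_ideal e K) <= waldschmidt R (cover_ideal e K).
Proof.
have sub := cover_symbolic_monomials e_nbip.
rewrite edge_ideal_sqfree // -[cover_ideal e K]/(sqfree_ideal K (minimal_vertex_cover e)).
split=> [n _|]; first exact: symbolic_power_sub.
have cT := vertex_cover_setT e.
have [i [j [eij _]]] := cover_contains_edge e_nbip cT.
have [D minD _] := minset_exists cT.
apply: (waldschmidt_le R K sub _ minD (C := [set i; j]%SET)).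
by apply/edgesP; exists i, j.
Qed.
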